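(* Let $R$ be a finite principal ideal ring (not necessarily commutative) and let $w: R\to\mathbb{Q}$ be a bi-invariant weight on $R$. Let $W$ be the matrix with rows indexed by the left ideals $Ra$ of $R$ and columns indexed by the right ideals $cR$ of $R$ (the zero ideals included) with entries $W_{Ra,cR}=w(ac)$, and let $Q$ be the matrix with rows indexed by the right ideals $cR$ and columns indexed by the left ideals $Rx$ with entries $Q_{cR,Rx}=\mu((Rx)^\perp, cR)$. Then the matrix $WQ$ is lower triangular, i.e., $(WQ)_{Ra,Rb}=0$ whenever $Rb\not\le Ra$, and for each left ideal $Ra$ its diagonal entry at position $(Ra,Ra)$ is $$(WQ)_{Ra,Ra}=\sum_{dR\le aR} w(d)\,\mu(0,dR),$$ the sum running over all right ideals $dR$ contained in $aR$ (including the zero ideal).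
   Context: All rings are finite, associative, with identity $1$, not necessarily commutative. $R^\times$ is the group of units of $R$. A principal ideal ring is a ring in which every left ideal is of the form $Rx$ and every right ideal is of the form $xR$. A weight on $R$ is any function $w:R\to\mathbb{Q}$; it is bi-invariant if $w(ux)=w(x)=w(xu)$ for all $x\in R$, $u\in R^\times$. In a finite ring two elements generate the same left (right) ideal iff they differ by left (right) multiplication by a unit; hence for bi-invariant $w$ the value $w(ac)$ depends only on $Ra$ and $cR$, and $w(d)$ depends only on $dR$. For a left ideal $I$ of $R$, $I^\perp=\{x\in R : Ix=0\}$ is its right annihilator, a right ideal. $\mu$ is the Möbius function of the lattice $L^*$ of all right ideals of $R$ ordered by inclusion, where the Möbius function of a finite poset is defined by $\mu(x,x)=1$, $\sum_{x\le t\le y}\mu(x,t)=0$ for $x<y$, and $\mu(x,y)=0$ if $x\not\le y$. *)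

(* Defs.v *)
From HB Require Import structures.
From mathcomp Require Import all_boot all_order all_algebra.

Set Implicit Arguments.
Unset Strict Implicit.
Unset Printing Implicit Defensive.

Import Order.TTheory GRing.Theory.
Local Open Scope ring_scope.

Section Moebius.
Variables (disp : Order.disp_t) (P : finPOrderType disp).
Implicit Types x y t : P.

(* The recursion goes down along chains below y, whose lengths are at most    *)
(* #|P|, so that the fuel is never exhausted (see moebius_sum).               *)
Fixpoint moebius_rec (n : nat) x y : int :=
  if x == y then 1
  else if n is m.+1 then
    if (x < y)%O then - \sum_(t : P | (x <= t < y)%O) moebius_rec m x t else 0
  else 0.

Definition moebius x y : int := moebius_rec #|P| x y.

Lemma moebiusxx x : moebius x x = 1.
Proof. by rewrite /moebius; case: #|P| => [|n] /=; rewrite eqxx. Qed.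

Lemma moebius_nle x y : ~~ (x <= y)%O -> moebius x y = 0.
Proof.
rewrite /moebius => nxy.
case: #|P| => [|n] /=; case: eqVneq nxy => [->|_]; rewrite ?lexx //.
by rewrite lt_neqAle => /negPf->; rewrite andbF.
Qed.

Lemma moebius_rec_stable n m x y :
    (#|[set t : P | (t < y)%O]| <= n)%N -> (#|[set t : P | (t < y)%O]| <= m)%N ->
  moebius_rec n x y = moebius_rec m x y.
Proof.
elim: n m x y => [|n IHn] [|m] x y //=.
- rewrite leqn0 cards_eq0 => /eqP y0 _.
  have/negbTE-> // : ~~ (x < y)%O by have /setP/(_ x) := y0; rewrite !inE => ->.
- move=> _; rewrite leqn0 cards_eq0 => /eqP y0.
  have/negbTE-> // : ~~ (x < y)%O by have /setP/(_ x) := y0; rewrite !inE => ->.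
move=> len lem; case: eqP => // _; case: ifP => // _; congr (- _).
apply: eq_bigr => t /andP[_ lt_ty].
have lt_card : (#|[set u : P | (u < t)%O]| < #|[set u : P | (u < y)%O]|)%N.
  apply: proper_card; apply/properP; split.
    by apply/subsetP => u; rewrite !inE => /lt_trans; apply.
  by exists t; rewrite !inE ?lt_ty // ltxx.
by apply: IHn; rewrite -ltnS; apply: leq_trans lt_card _.
Qed.

Lemma moebius_lt x y : (x < y)%O ->
  moebius x y = - \sum_(t : P | (x <= t < y)%O) moebius x t.
Proof.
move=> lt_xy; have -> : moebius x y = moebius_rec #|P|.+1 x y.
  by apply: moebius_rec_stable; rewrite ?leqW ?max_card.
by rewrite /= lt_xy (lt_eqF lt_xy).
Qed.

Lemma moebius_sum x y :
  (x < y)%O -> \sum_(t : P | (x <= t <= y)%O) moebius x t = 0.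
Proof.
move=> lt_xy; rewrite (bigD1 y) ?lexx ?(ltW lt_xy) //= (moebius_lt lt_xy).
rewrite addrC; apply/eqP; rewrite subr_eq0; apply/eqP.
by apply: eq_bigl => t; rewrite lt_neqAle -andbA [(t != y) && _]andbC.
Qed.

End Moebius.

Section Ideals.
Variable R : finPzRingType.
Implicit Types (A : {set R}) (a b c x u : R).

Definition left_ideal A :=
  [&& 0 \in A, [forall x in A, forall y in A, x - y \in A]
    & [forall r : R, forall x in A, r * x \in A]].

Definition right_ideal A :=
  [&& 0 \in A, [forall x in A, forall y in A, x - y \in A]
    & [forall r : R, forall x in A, x * r \in A]].

Record lideal := LIdeal { lideal_set :> {set R}; _ : left_ideal lideal_set }.
Record rideal := RIdeal { rideal_set :> {set R}; _ : right_ideal rideal_set }.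

HB.instance Definition _ := [isSub for lideal_set].
HB.instance Definition _ := [Finite of lideal by <:].
HB.instance Definition _ := [isSub for rideal_set].
HB.instance Definition _ := [Finite of rideal by <:].

Definition lideal_le (I J : lideal) := I \subset J.
Definition rideal_le (I J : rideal) := I \subset J.

Fact lideal_le_refl : reflexive lideal_le.
Proof. by move=> I; apply: subxx. Qed.
Fact lideal_le_anti : antisymmetric lideal_le.
Proof. by move=> I J sIJ; apply/val_inj/eqP; rewrite eqEsubset. Qed.
Fact lideal_le_trans : transitive lideal_le.
Proof. by move=> J I K; apply: subset_trans. Qed.
Fact rideal_le_refl : reflexive rideal_le.
Proof. by move=> I; apply: subxx. Qed.
Fact rideal_le_anti : antisymmetric rideal_le.
Proof. by move=> I J sIJ; apply/val_inj/eqP; rewrite eqEsubset. Qed.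
Fact rideal_le_trans : transitive rideal_le.
Proof. by move=> J I K; apply: subset_trans. Qed.

Fact ideal_display : Order.disp_t. Proof. exact: Order.Disp tt tt. Qed.
HB.instance Definition _ := Order.Le_isPOrder.Build ideal_display lideal
  lideal_le_refl lideal_le_anti lideal_le_trans.
HB.instance Definition _ := Order.Le_isPOrder.Build ideal_display rideal
  rideal_le_refl rideal_le_anti rideal_le_trans.

Lemma lidealP (I : lideal) :
  [/\ 0 \in I, {in I &, forall x y, x - y \in I}
    & forall r, {in I, forall x, r * x \in I}].
Proof.
case: I => A /= /and3P[A0 AB AM]; split=> // [x y Ax Ay | r x Ax].
  by move/forall_inP/(_ x Ax)/forall_inP/(_ y Ay): AB.
by move/forallP/(_ r)/forall_inP/(_ x Ax): AM.
Qed.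

Fact lprinc_subproof a : left_ideal [set r * a | r : R].
Proof.
apply/and3P; split.
- by apply/imsetP; exists 0; rewrite ?mul0r.
- apply/forall_inP => _ /imsetP[r _ ->]; apply/forall_inP => _ /imsetP[s _ ->].
  by apply/imsetP; exists (r - s); rewrite ?mulrBl.
- apply/forallP => r; apply/forall_inP => _ /imsetP[s _ ->].
  by apply/imsetP; exists (r * s); rewrite ?mulrA.
Qed.
Definition lprinc a : lideal := LIdeal (lprinc_subproof a).

Fact rprinc_subproof c : right_ideal [set c * r | r : R].
Proof.
apply/and3P; split.
- by apply/imsetP; exists 0; rewrite ?mulr0.
- apply/forall_inP => _ /imsetP[r _ ->]; apply/forall_inP => _ /imsetP[s _ ->].
  by apply/imsetP; exists (r - s); rewrite ?mulrBr.
- apply/forallP => r; apply/forall_inP => _ /imsetP[s _ ->].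
  by apply/imsetP; exists (s * r); rewrite ?mulrA.
Qed.
Definition rprinc c : rideal := RIdeal (rprinc_subproof c).

Fact rann_subproof (I : lideal) :
  right_ideal [set x : R | [forall y in I, y * x == 0]].
Proof.
apply/and3P; split.
- by rewrite inE; apply/forall_inP => y _; rewrite mulr0.
- apply/forall_inP => x; rewrite inE => /forall_inP Ix0.
  apply/forall_inP => z; rewrite inE => /forall_inP Iz0; rewrite inE.
  apply/forall_inP => y Iy.
  by rewrite mulrBr (eqP (Ix0 y Iy)) (eqP (Iz0 y Iy)) subr0.
- apply/forallP => r; apply/forall_inP => x; rewrite !inE => /forall_inP Ix0.
  by apply/forall_inP => y Iy; rewrite mulrA (eqP (Ix0 y Iy)) mul0r.
Qed.
Definition rann (I : lideal) : rideal := RIdeal (rann_subproof I).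

Definition is_unit u := exists v, u * v = 1 /\ v * u = 1.

Definition principal_ideal_ring :=
  (forall I : lideal, exists a, I = lprinc a)
  /\ (forall J : rideal, exists c, J = rprinc c).

Definition biinvariant (w : R -> rat) :=
  forall x u, is_unit u -> w (u * x) = w x /\ w x = w (x * u).

(* A chosen generator (0 if the ideal is not principal). For bi-invariant w    *)
(* the choice is immaterial below: see weight_mxE and weight_rgenE.            *)
Definition lgen (I : lideal) : R := odflt 0 [pick a | lprinc a == I].
Definition rgen (J : rideal) : R := odflt 0 [pick c | rprinc c == J].

Definition weight_mx (w : R -> rat) : 'M[rat]_(#|{: lideal}|, #|{: rideal}|) :=
  \matrix_(i, j) w (lgen (enum_val i) * rgen (enum_val j)).

Definition moebius_mx : 'M[rat]_(#|{: rideal}|, #|{: lideal}|) :=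
  \matrix_(j, i) (moebius (rann (enum_val i)) (enum_val j))%:~R.

Lemma is_unitP x y : y * x = 1 -> is_unit x.
Proof.
move=> yx1; have inj_x : injective ( *%R x).
  by move=> r s /(congr1 ( *%R y)); rewrite !mulrA yx1 !mul1r.
have [g _ gK] := injF_bij inj_x; exists y; split=> //.
have : y * (x * g 1) = g 1 by rewrite mulrA yx1 mul1r.
by rewrite gK mulr1 => ->; rewrite gK.
Qed.

(* For fixed b, the set of x with x * b = s * b is a coset of the left         *)
(* annihilator of b. If b \in R * (s * b), the number of its elements that     *)
(* generate a given left ideal does not depend on s; s = 1 yields a unit.      *)
Lemma lprinc_eq_unit a b : lprinc a = lprinc b -> exists2 u, is_unit u & a = u * b.
Proof.
move=> eq_ab.
have [s a_sb] : exists s, a = s * b.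
  have : a \in lprinc b by rewrite -eq_ab; apply/imsetP; exists 1; rewrite ?mul1r.
  by case/imsetP=> s _ ->; exists s.
have [t b_ta] : exists t, b = t * a.
  have : b \in lprinc a by rewrite eq_ab; apply/imsetP; exists 1; rewrite ?mul1r.
  by case/imsetP=> t _ ->; exists t.
pose good z := exists t, t * z * b = b.
pose N z (I : lideal) := #|[set x in I | x * b == z * b]|.
pose h z (I : lideal) := #|[set x | (x * b == z * b) && (lprinc x == I)]|.
have leN z z' I : good z -> (N z I <= N z' I)%N.
  move=> [p pzb]; rewrite /N.
  have [->|[x0]] := set_0Vmem [set x in I | x * b == z * b].
    by rewrite cards0.
  rewrite inE => /andP[Ix0 /eqP x0b].
  have [I0 IB IM] := lidealP I.
  have ID : {in I &, forall x y, x + y \in I}.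
    move=> x y Ix Iy; rewrite -[y]opprK IB //.
    by rewrite -[- y]sub0r IB.
  pose f x := (x - x0) + z' * p * x0.
  have inj_f : injective f by move=> x y /addIr/addIr.
  rewrite -(card_imset _ inj_f) subset_leq_card //; apply/subsetP => y /imsetP[x].
  rewrite inE => /andP[Ix /eqP xb] ->; rewrite inE ID ?IB ?IM //=.
  by rewrite mulrDl mulrBl xb x0b subrr add0r -!mulrA x0b [p * _]mulrA pzb.
have Nh z I : N z I = (\sum_(J : lideal | (J <= I)%O) h z J)%N.
  rewrite /N -sum1_card (partition_big (fun x => lprinc x) (fun J => J <= I)%O) /=.
    apply: eq_bigr => J leJI; rewrite /h -sum1_card; apply: eq_bigl => x.
    rewrite !inE; case: (lprinc x =P J) => [xJ|]; rewrite ?andbF // !andbT.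
    have -> // : x \in I.
    apply: (subsetP leJI); rewrite -xJ.
    by apply/imsetP; exists 1; rewrite ?mul1r.
  move=> x; rewrite inE => /andP[Ix _]; apply/subsetP => _ /imsetP[r _ ->].
  by have [_ _] := lidealP I; apply.
have eqh z z' I : good z -> good z' -> h z I = h z' I.
  move=> gz gz'; have [n] := ubnP #|I|; elim: n I => // n IHn I; rewrite ltnS => leIn.
  have: N z I = N z' I by apply/eqP; rewrite eqn_leq !leN.
  rewrite !Nh (bigD1 I) //= [RHS](bigD1 I) //=.
  rewrite [X in (_ + X)%N = _](_ : _ = (\sum_(J | (J <= I)%O && (J != I)) h z' J)%N).
    by move/eqP; rewrite eqn_add2r => /eqP.
  apply: eq_bigr => J /andP[leJI neJI]; apply: IHn; apply: leq_trans leIn.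
  apply: proper_card; rewrite properEneq; apply/andP; split; last exact: leJI.
  by apply: contraNneq neJI => /val_inj->.
have : (0 < h s (lprinc 1%R))%N.
  rewrite (@eqh s 1).
  - by apply/card_gt0P; exists 1; rewrite inE !eqxx.
  - by exists t; rewrite -mulrA -a_sb -b_ta.
  - by exists 1; rewrite !mul1r.
case/card_gt0P=> u; rewrite inE => /andP[/eqP ub /eqP u1].
exists u; last by rewrite ub.
have : 1 \in lprinc u by rewrite u1; apply/imsetP; exists 1; rewrite ?mul1r.
by case/imsetP=> y _ /esym; apply: is_unitP.
Qed.

End Ideals.

Arguments moebius_mx R : clear implicits.

HB.instance Definition _ (R : finPzRingType) := Finite.copy R^c R.

Lemma rprinc_eq_unit (R : finPzRingType) (a b : R) :
  rprinc a = rprinc b -> exists2 u, is_unit u & a = b * u.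
Proof.
move=> eq_ab; have /lprinc_eq_unit[u [v [uv vu]] ->] :
    lprinc (a : R^c) = lprinc (b : R^c).
  by apply: val_inj; have /(congr1 val) := eq_ab.
by exists u => //; exists v.
Qed.

Lemma weight_mxE (R : finPzRingType) (w : R -> rat) (a c : R) :
    biinvariant w ->
  weight_mx w (enum_rank (lprinc a)) (enum_rank (rprinc c)) = w (a * c).
Proof.
move=> inv_w; rewrite mxE !enum_rankK /lgen /rgen.
case: pickP => [a' /eqP/lprinc_eq_unit[u Uu ->]|/(_ a)]; rewrite ?eqxx //=.
case: pickP => [c' /eqP/rprinc_eq_unit[v Uv ->]|/(_ c)]; rewrite ?eqxx //=.
rewrite mulrA -(inv_w _ _ Uv).2 -mulrA.
by rewrite (inv_w _ _ Uu).1.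
Qed.

Lemma weight_rgenE (R : finPzRingType) (w : R -> rat) (d : R) :
  biinvariant w -> w (rgen (rprinc d)) = w d.
Proof.
move=> inv_w; rewrite /rgen.
case: pickP => [c /eqP/rprinc_eq_unit[v Uv ->]|/(_ d)]; rewrite ?eqxx //=.
by rewrite -(inv_w _ _ Uv).2.
Qed.

(* Main.v *)
(* The entry of W Q at (Ra, Rb) is the sum over J <= aR of w(J) S(J), where    *)
(* S(J) is the sum of mu((Rb)^perp, C) over the right ideals C with a C = J.   *)
(* As C |-> a C is left adjoint to J |-> a^-1 J, the sum of S over the ideals  *)
(* below J is 1 if (Rb)^perp = a^-1 J and 0 otherwise. Since a^-1 J contains   *)
(* (Ra)^perp, this gives S = 0 unless (Ra)^perp <= (Rb)^perp; for b = a and    *)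
(* J <= aR the condition reads J = 0, whence S(J) = mu(0, J).                  *)
(* It remains to see that (Ra)^perp <= (Rb)^perp implies Rb <= Ra, which holds *)
(* because |I^perp| |I| = |R| for all left ideals I: the left side is          *)
(* monotone in I (by the bound |M^perp| <= |R / M| for maximal M, applied      *)
(* along a chain of covers), and it equals |R| for I = 0 and I = R.            *)
Require Import Defs.
From HB Require Import structures.
From mathcomp Require Import all_boot all_order all_algebra.

Set Implicit Arguments.
Unset Strict Implicit.
Unset Printing Implicit Defensive.

Import Order.TTheory GRing.Theory.
Local Open Scope ring_scope.

(** Since $w(ac)$ depends only on $acR$, an entry of $WQ$ is grouped along the fibres of $C \mapsto
    aC$ ([weight_moebius_mxE]). A function on a finite poset is determined by its sums over
    principal down-sets ([eq_of_sum_le]), and the adjunction [rmul_le] turns these sums, for the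
    fibre sums of $\mu$, into a Kronecker delta ([sum_le_fiber_moebius]). The fibre sums are thus
    known in the two cases that matter: [sum_fiber_rmul_eq0] off the diagonal, [sum_fiber_rmul] on
    it. Triangularity then needs annihilators to reflect inclusion ([lprinc_le_rann]). This is a
    count: by [card_rann], a strictly larger left ideal has a strictly smaller annihilator.
    Principality of left ideals enters through [card_rann_max]. *)

(** * Möbius sums over down-sets and along adjunctions; counting by fibres *)

Section PosetSums.
Variables (disp : Order.disp_t) (P : finPOrderType disp).
Implicit Types x y t K : P.

Lemma sum_le_moebius x y : \sum_(t : P | (t <= y)%O) moebius x t = (x == y)%:R.
Proof.
rewrite (bigID (fun t => (x <= t)%O)) /= [X in _ + X]big1 ?addr0; last first.
  by move=> t /andP[_ /moebius_nle].
under eq_bigl => t do rewrite andbC.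
have [<-|ne_xy] := eqVneq x y.
  rewrite (big_pred1 x) ?moebiusxx // => t /=.
  by rewrite -eq_le eq_sym.
have [le_xy|nle_xy] := boolP (x <= y)%O.
  by apply: moebius_sum; rewrite lt_neqAle ne_xy.
rewrite big_pred0 // => t; apply: contraNF nle_xy => /andP[].
exact: le_trans.
Qed.

(** Strong induction on the number of elements below [y]: cancelling the terms below [y] leaves the
    term at [y]. The bound [K] allows for sums that are known only below $aR$. *)
Lemma eq_of_sum_le (V : zmodType) (f g : P -> V) K :
    (forall y, (y <= K)%O ->
       \sum_(t | (t <= y)%O) f t = \sum_(t | (t <= y)%O) g t) ->
  forall y, (y <= K)%O -> f y = g y.
Proof.
move=> eq_fg y; have [n] := ubnP #|[set t : P | (t < y)%O]|.
elim: n y => // n IHn y le_n le_yK.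
have := eq_fg y le_yK; rewrite (bigD1 y) //= [RHS](bigD1 y) //=.
rewrite [X in _ + X = _](eq_bigr g); first exact: addIr.
move=> t /andP[le_ty ne_ty]; have lt_ty : (t < y)%O by rewrite lt_neqAle ne_ty.
apply: IHn; last exact: le_trans le_ty le_yK.
rewrite ltnS in le_n; apply: leq_trans le_n; apply: proper_card.
apply/properP; split; last by exists t; rewrite !inE ?lt_ty ?ltxx.
by apply/subsetP => u; rewrite !inE => /lt_trans; apply.
Qed.

End PosetSums.

(** The fibres over the elements below [y] together consist of the [p] with [f p <= y], that is,
    [p <= g y]. *)
Lemma sum_le_fiber_moebius (d d' : Order.disp_t) (P : finPOrderType d)
    (Q : finPOrderType d') (f : P -> Q) (g : Q -> P) (x : P) (y : Q) :
    (forall p q, (f p <= q)%O = (p <= g q)%O) ->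
  \sum_(t | (t <= y)%O) \sum_(p | f p == t) moebius x p = (x == g y)%:R.
Proof.
move=> adj; rewrite -(sum_le_moebius x (g y)).
rewrite (partition_big f (fun t => (t <= y)%O)) /=; last by move=> p; rewrite adj.
apply: eq_bigr => t le_ty; apply: eq_bigl => p.
by rewrite -adj; case: eqP => [->|]; rewrite ?le_ty ?andbF.
Qed.

Lemma leq_card_fibers (T U : finType) (D : {set T}) (E : {set U}) (f : T -> U)
    (n : nat) :
    {in D, forall x, f x \in E} ->
    {in D, forall x, (#|[set z in D | f z == f x]| <= n)%N} ->
  (#|D| <= #|E| * n)%N.
Proof.
move=> fDE le_n; rewrite -sum1_card (partition_big f (mem E)) //=.
rewrite -sum_nat_const leq_sum // => y Ey.
have -> : (\sum_(z in D | f z == y) 1 = #|[set z in D | f z == y]|)%N.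
  by rewrite -sum1_card; apply: eq_bigl => z; rewrite !inE.
have [->|[x]] := set_0Vmem [set z in D | f z == y]; first by rewrite cards0.
by rewrite inE => /andP[Dx /eqP<-]; apply: le_n.
Qed.

(** * Left ideals and the size of their right annihilators *)

Section Frobenius.
Variable R : finPzRingType.
Implicit Types (A : {set R}) (a b c x y : R) (I J M : lideal R).

Lemma lideal0 I : 0 \in I. Proof. by case: (lidealP I). Qed.

Lemma lidealB I x y : x \in I -> y \in I -> x - y \in I.
Proof. by case: (lidealP I) => _ + _; apply. Qed.

Lemma lidealM I r x : x \in I -> r * x \in I.
Proof. by case: (lidealP I) => _ _; apply. Qed.

Lemma lidealN I x : x \in I -> - x \in I.
Proof. by move=> Ix; rewrite -mulN1r lidealM. Qed.

Lemma lidealD I x y : x \in I -> y \in I -> x + y \in I.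
Proof. by move=> Ix Iy; rewrite -[y]opprK lidealB ?lidealN. Qed.

Lemma lideal_sum I (T : finType) (D : pred T) (F : T -> R) :
  (forall i, D i -> F i \in I) -> \sum_(i | D i) F i \in I.
Proof.
move=> IF; elim/big_rec: _ => [|i x Di Ix]; first exact: lideal0.
by rewrite lidealD ?IF.
Qed.

Lemma left_idealI A :
    0 \in A -> {in A &, forall x y, x - y \in A} ->
    (forall r, {in A, forall x, r * x \in A}) ->
  left_ideal A.
Proof.
move=> A0 AB AM; apply/and3P; split=> //.
- by apply/forall_inP => x Ax; apply/forall_inP => y Ay; apply: AB.
- by apply/forallP => r; apply/forall_inP => x Ax; apply: AM.
Qed.

Lemma mem_lprinc a : a \in lprinc a.
Proof. by apply/imsetP; exists 1; rewrite ?mul1r. Qed.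

Lemma lprinc_le a I : (lprinc a <= I)%O = (a \in I).
Proof.
apply/idP/idP => [/subsetP/(_ _ (mem_lprinc a)) //|Ia].
by apply/subsetP => _ /imsetP[r _ ->]; apply: lidealM.
Qed.

Lemma rannP I x : reflect {in I, forall y, y * x = 0} (x \in rann I).
Proof. by rewrite inE; apply: (iffP forall_inP) => h y /h/eqP. Qed.

Lemma rann_lprinc a x : (x \in rann (lprinc a)) = (a * x == 0).
Proof.
apply/rannP/eqP => [->//|ax0 _ /imsetP[r _ ->]]; first exact: mem_lprinc.
by rewrite -mulrA ax0 mulr0.
Qed.

Fact lspan_subproof A :
  left_ideal [set \sum_(x in A) f x * x | f : {ffun R -> R}].
Proof.
apply: left_idealI => [|_ _ /imsetP[f _ ->] /imsetP[g _ ->]|r _ /imsetP[f _ ->]].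
- apply/imsetP; exists [ffun=> 0] => //.
  by rewrite big1 // => x _; rewrite ffunE mul0r.
- apply/imsetP; exists [ffun x => f x - g x] => //.
  by rewrite -sumrB; apply: eq_bigr => x _; rewrite ffunE mulrBl.
- apply/imsetP; exists [ffun x => r * f x] => //.
  by rewrite mulr_sumr; apply: eq_bigr => x _; rewrite ffunE mulrA.
Qed.
Definition lspan A : lideal R := LIdeal (lspan_subproof A).

Lemma mem_lspan A a : a \in A -> a \in lspan A.
Proof.
move=> Aa; apply/imsetP; exists [ffun x => (x == a)%:R] => //.
rewrite (bigD1 a) //= ffunE eqxx mul1r big1 ?addr0 // => x /andP[_ /negPf xa].
by rewrite ffunE xa mul0r.
Qed.

Lemma lspan_le A I : A \subset I -> (lspan A <= I)%O.
Proof.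
move=> /subsetP sAI; apply/subsetP => _ /imsetP[f _ ->].
by apply: lideal_sum => x /sAI; apply: lidealM.
Qed.

Fact ladd_subproof I a : left_ideal [set i + x * a | i in I, x in R].
Proof.
apply: left_idealI => [|_ _ /imset2P[i x Ii _ ->] /imset2P[j y Ij _ ->]
                       |r _ /imset2P[i x Ii _ ->]].
- by apply/imset2P; exists 0 0; rewrite ?lideal0 ?mul0r ?addr0.
- apply/imset2P; exists (i - j) (x - y); rewrite ?lidealB //.
  by rewrite mulrBl opprD addrACA.
- by apply/imset2P; exists (r * i) (r * x); rewrite ?lidealM // mulrDr mulrA.
Qed.
Definition ladd I a : lideal R := LIdeal (ladd_subproof I a).

Lemma ladd_le I a J : (ladd I a <= J)%O = (I <= J)%O && (a \in J).
Proof.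
apply/idP/andP => [/subsetP le_J|[/subsetP le_IJ Ja]].
  split; last first.
    by apply: le_J; apply/imset2P; exists 0 1; rewrite ?lideal0 ?mul1r ?add0r.
  apply/subsetP => i Ii; apply: le_J.
  by apply/imset2P; exists i 0; rewrite // mul0r addr0.
apply/subsetP => _ /imset2P[i x Ii _ ->].
by rewrite lidealD ?lidealM // le_IJ.
Qed.

Lemma le_ladd I a : (I <= ladd I a)%O.
Proof. by have := lexx (ladd I a); rewrite ladd_le => /andP[]. Qed.

Lemma mem_ladd I a : a \in ladd I a.
Proof. by have := lexx (ladd I a); rewrite ladd_le => /andP[]. Qed.

Fact lcolon_subproof I a : left_ideal [set x | x * a \in I].
Proof.
apply: left_idealI => [|x y|r x]; rewrite !inE.
- by rewrite mul0r lideal0.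
- by move=> *; rewrite mulrBl lidealB.
- by move=> *; rewrite -mulrA lidealM.
Qed.
Definition lcolon I a : lideal R := LIdeal (lcolon_subproof I a).

(* Write H = R h for the left ideal generated by M^perp, a direct sum of copies *)
(* R x of R / M (x in A). A homomorphism R / M -> H is a family (d x) of       *)
(* endomorphisms of R / M, hence also yields a homomorphism H -> R / M, which  *)
(* is determined by the image of h.                                            *)
Lemma card_rann_max M :
    (forall I, exists a, I = lprinc a) ->
    (forall x, x \notin M -> exists y, 1 - y * x \in M) ->
  (#|rann M| * #|M| <= #|R|)%N.
Proof.
move=> lpid maxM.
pose spans A := (A \subset rann M) && (rann M \subset lspan A).
have : spans (rann M).
  by rewrite /spans subxx; apply/subsetP => x; apply: mem_lspan.
case/minset_exists => A /minsetP[/andP[sA spA] minA] _.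
have A0 x m : x \in A -> m \in M -> m * x = 0.
  by move=> /(subsetP sA)/rannP; apply.
(* A coefficient outside [M] is invertible modulo [M], and [M] kills [x]; so [x] would lie in the
   span of the other elements, against the minimality of [A]. *)
have freeA (f : R -> R) : \sum_(x in A) f x * x = 0 -> {in A, forall x, f x \in M}.
  move=> f0 x Ax; apply: contraT => /maxM[y My].
  suff /minA/(_ (subD1set _ _))/setP/(_ x) : spans (A :\ x).
    by rewrite !inE eqxx Ax.
  apply/andP; split; first exact: subset_trans (subD1set _ _) sA.
  apply: subset_trans spA _; apply: lspan_le; apply/subsetP => z Az.
  have [->|ne_zx] := eqVneq z x; last by rewrite mem_lspan // !inE ne_zx.
  have def_x : x = - (y * \sum_(z in A | z != x) f z * z).
    have := A0 _ _ Ax My; move: f0; rewrite (bigD1 x) //= => /eqP.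
    rewrite addr_eq0 => /eqP fx; rewrite mulrBl mul1r -mulrA fx => /eqP.
    by rewrite subr_eq0 mulrN => /eqP.
  rewrite {1}def_x lidealN // lidealM //; apply: lideal_sum => t /andP[At ne_tx].
  by rewrite lidealM // mem_lspan // !inE ne_tx.
have [h defH] := lpid (lspan A).
have /imsetP[c _ def_h] : h \in lspan A by rewrite defH mem_lprinc.
have gen x : exists y, x \in A -> x = y * h.
  have [Ax|] := boolP (x \in A); last by exists 0.
  have : x \in lprinc h by rewrite -defH mem_lspan.
  by case/imsetP=> y _ ->; exists y.
have [g gP] := fin_all_exists gen.
have gc x z : x \in A -> z \in A -> g x * c z - (z == x)%:R \in M.
  move=> Ax Az; apply: (freeA (fun z => g x * c z - (z == x)%:R) _ z Az).
  under eq_bigr => t _ do rewrite mulrBl -mulrA.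
  rewrite sumrB -mulr_sumr -def_h -gP // (bigD1 x) //= eqxx mul1r big1 ?addr0.
    exact: subrr.
  by move=> t /andP[_ /negPf->]; rewrite mul0r.
have coord s : exists d : {ffun R -> R},
    s \in rann M -> s = \sum_(x in A) d x * x.
  have [Ms|] := boolP (s \in rann M); last by exists 0.
  by have /imsetP[d _ ->] := subsetP spA s Ms; exists d.
have [d dP] := fin_all_exists coord.
(* Right multiplication by [d s x] thus induces an endomorphism of $R/M$. *)
have dM s x m : s \in rann M -> x \in A -> m \in M -> m * d s x \in M.
  move=> Ms Ax Mm; apply: (freeA (fun x => m * d s x) _ x Ax).
  under eq_bigr => z _ do rewrite -mulrA.
  by rewrite -mulr_sumr -dP //; move/rannP: Ms; apply.
(* [e s] represents the image of [h] under the homomorphism to $R/M$ that sends each [x] in [A] to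
   the class of [d s x]. As [x = g x * h], the class of [e s] recovers these coordinates, hence
   [s]. *)
pose e s := \sum_(x in A) c x * d s x.
have eP s x : s \in rann M -> x \in A -> g x * e s - d s x \in M.
  move=> Ms Ax; have -> : g x * e s - d s x
      = \sum_(z in A) (g x * c z - (z == x)%:R) * d s z.
    under eq_bigr => z _ do rewrite mulrBl -mulrA.
    rewrite sumrB -mulr_sumr; congr (_ - _); rewrite (bigD1 x) //= eqxx mul1r.
    by rewrite big1 ?addr0 // => z /andP[_ /negPf->]; rewrite mul0r.
  by apply: lideal_sum => z Az; rewrite dM ?gc.
have inj_e : {in setX (rann M) M &, injective (fun p => e p.1 + p.2)}.
  move=> [s m] [t n] /setXP[/= Ms Mm] /setXP[/= Mt Mn] eq_e.
  have Me : e s - e t \in M.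
    have -> : e s - e t = n - m.
      by apply/eqP; rewrite subr_eq addrAC eq_sym subr_eq eq_e addrC.
    exact: lidealB.
  have eq_st : s = t.
    rewrite (dP s) // (dP t) //; apply/eqP; rewrite -subr_eq0 -sumrB.
    apply/eqP/big1 => x Ax; rewrite -mulrBl A0 //.
    have -> : d s x - d t x
        = g x * (e s - e t) - ((g x * e s - d s x) - (g x * e t - d t x)).
      rewrite mulrBr (opprD (g x * e t)) [X in _ = _ - X]addrACA -opprD.
      by rewrite subKr.
    by rewrite lidealB ?lidealM // lidealB ?eP.
  by move: eq_e; rewrite eq_st => /addrI->.
rewrite -cardsX -(card_in_imset inj_e); exact: max_card.
Qed.

(** With $M = (I : a)$, the quotient $(I + Ra)/I$ is isomorphic to $R/M$, so the covering condition
    gives [M] the property required by [card_rann_max]. Multiplication by [a] maps $I^\perp$ to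
    $M^\perp$ with kernel $(I + Ra)^\perp$. *)
Lemma card_rann_cover I a :
    (forall J, exists c, J = lprinc c) ->
    (forall J, (I < J)%O -> (J <= ladd I a)%O -> J = ladd I a) ->
  (#|rann I| * #|I| <= #|rann (ladd I a)| * #|ladd I a|)%N.
Proof.
move=> lpid cov; pose M := lcolon I a.
have leM : (#|rann M| * #|M| <= #|R|)%N.
  apply: card_rann_max => // x; rewrite inE => nIxa.
  have := mem_ladd I a; rewrite -(cov (ladd I (x * a))).
  - case/imset2P=> i y Ii _ def_a; exists y; rewrite inE.
    by rewrite mulrBl mul1r {1}def_a -mulrA addrK.
  - rewrite lt_neqAle le_ladd andbT; apply: contraNneq nIxa => ->.
    exact: mem_ladd.
  - by rewrite ladd_le le_ladd lidealM ?mem_ladd.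
have leR : (#|R| * #|I| <= #|ladd I a| * #|M|)%N.
  rewrite -cardsT -cardsX.
  apply: (@leq_card_fibers _ _ _ _ (fun p => p.2 + p.1 * a)).
    by move=> [x i] /setXP[_ Ii]; apply/imset2P; exists i x.
  move=> [x i] /setXP[_ /= Ii].
  (* Within a fibre the first component determines the second, and differences of first components
     lie in [M]. *)
  rewrite -(card_in_imset (f := fun p : R * R => p.1 - x)).
    apply: subset_leq_card; apply/subsetP => _ /imsetP[[y j] + ->] /=.
    rewrite !inE /= => /andP[Ij /eqP eq_ij]; rewrite mulrBl.
    have -> : y * a - x * a = i - j; last exact: lidealB.
    by apply/eqP; rewrite subr_eq addrAC eq_sym subr_eq -eq_ij addrC.
  move=> [y j] [z k]; rewrite !inE /= => /andP[_ /eqP yj] /andP[_ /eqP zk].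
  by move=> /addIr eq_yz; move: yj; rewrite -zk -eq_yz => /addIr->.
have ler : (#|rann I| <= #|rann M| * #|rann (ladd I a)|)%N.
  apply: (@leq_card_fibers _ _ _ _ ( *%R a)).
    move=> c /rannP Ic; apply/rannP => x; rewrite inE mulrA; exact: Ic.
  move=> c /rannP Ic; rewrite -(card_imset _ (addIr (- c))).
  apply: subset_leq_card; apply/subsetP => _ /imsetP[b + ->].
  rewrite in_set => /andP[/rannP Ib /eqP eq_ab].
  apply/rannP => _ /imset2P[i x Ii _ ->].
  by rewrite mulrDl !mulrBr Ib // Ic // -!mulrA eq_ab !subrr addr0.
have R_gt0 : (0 < #|R|)%N by apply/card_gt0P; exists 0.
rewrite -(leq_pmul2l R_gt0).
apply: leq_trans (leq_mul leM (leqnn _)).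
rewrite mulnCA; apply: leq_trans (leq_mul ler leR) _.
by rewrite [X in (_ * X)%N]mulnC mulnACA.
Qed.

Lemma card_rann_mono I J :
    (forall K : lideal R, exists c, K = lprinc c) -> (I <= J)%O ->
  (#|rann I| * #|I| <= #|rann J| * #|J|)%N.
Proof.
move=> lpid; have [n] := ubnP (#|J| - #|I|)%N.
elim: n I => // n IHn I le_n le_IJ.
have [-> //|ne_IJ] := eqVneq I J.
have lt_IJ : (I < J)%O by rewrite lt_neqAle ne_IJ.
have card_lt (K L : lideal R) : (K < L)%O -> (#|K| < #|L|)%N.
  rewrite lt_neqAle => /andP[ne_KL le_KL]; apply: proper_card.
  by rewrite properEneq; apply/andP; split; last exact: le_KL.
(* An ideal [K] of least size strictly above [I] and inside [J] leaves no room for an ideal strictly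
   between [I] and [ladd I a]. *)
have [|K /andP[lt_IK le_KJ] minK] :=
    @arg_minnP _ J (fun K => (I < K)%O && (K <= J)%O) (fun K => #|K|).
  by rewrite lt_IJ /=.
have /subsetPn[a Ka nIa] : ~~ (K \subset I).
  by move: lt_IK; rewrite lt_leAnge => /andP[_].
have lt_Ia : (I < ladd I a)%O.
  rewrite lt_neqAle le_ladd andbT; apply: contraNneq nIa => ->.
  exact: mem_ladd.
have le_aK : (ladd I a <= K)%O by rewrite ladd_le Ka ltW.
have le_aJ := le_trans le_aK le_KJ.
apply: leq_trans (card_rann_cover lpid _) (IHn (ladd I a) _ le_aJ).
  move=> L lt_IL le_La; apply/eqP; apply: contraT => ne_La.
  have : (#|L| < #|K|)%N.
    apply: leq_trans (subset_leq_card le_aK); apply: card_lt.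
    by rewrite lt_neqAle ne_La.
  by rewrite ltnNge minK // lt_IL (le_trans le_La).
rewrite ltnS in le_n; apply: leq_trans le_n.
by rewrite ltn_sub2l ?card_lt.
Qed.

(** By [card_rann_mono] the product lies between its values at the zero ideal and at [R], and both
    are [#|R|]. *)
Lemma card_rann I :
    (forall J, exists a, J = lprinc a) -> (#|rann I| * #|I| = #|R|)%N.
Proof.
move=> lpid; apply/eqP; rewrite eqn_leq.
have le0 : (lprinc 0 <= I)%O by rewrite lprinc_le lideal0.
have le1 : (I <= lprinc 1)%O.
  by apply/subsetP => x _; rewrite -[x]mulr1 lidealM ?mem_lprinc.
apply/andP; split.
- apply: leq_trans (card_rann_mono lpid le1) _.
  have -> : rann (lprinc 1) = [set 0] :> {set R}.
    by apply/setP => x; rewrite rann_lprinc mul1r inE.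
  by rewrite cards1 mul1n max_card.
- apply: leq_trans (card_rann_mono lpid le0).
  have -> : rann (lprinc 0) = setT :> {set R}.
    by apply/setP => x; rewrite rann_lprinc mul0r inE eqxx.
  by rewrite cardsT leq_pmulr //; apply/card_gt0P; exists 0; apply: lideal0.
Qed.

(** Under the hypothesis $Ra + Rb$ has the same annihilator as $Ra$, hence the same size, so the two
    coincide. *)
Lemma lprinc_le_rann a b :
    (forall J, exists c, J = lprinc c) ->
  (rann (lprinc a) <= rann (lprinc b))%O -> (lprinc b <= lprinc a)%O.
Proof.
move=> lpid /subsetP le_ab; pose I := ladd (lprinc a) b.
have eq_r : rann I = rann (lprinc a).
  apply: val_inj; apply/setP => x; apply/rannP/rannP => h y.
    by move=> ay; apply: h; move: y ay; apply/subsetP; apply: le_ladd.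
  case/imset2P=> i r ai _ ->.
  rewrite mulrDl h // -mulrA; have /le_ab : x \in rann (lprinc a) by apply/rannP.
  by rewrite rann_lprinc => /eqP->; rewrite mulr0 addr0.
have := card_rann I lpid; rewrite -(card_rann (lprinc a) lpid) eq_r.
move/eqP; rewrite eqn_pmul2l; last first.
  by apply/card_gt0P; exists 0; rewrite rann_lprinc mulr0.
move=> /eqP eq_card.
have /eqP eqI : lprinc a == I :> {set R}.
  by rewrite eqEcard eq_card leqnn andbT; apply: le_ladd.
by rewrite lprinc_le eqI mem_ladd.
Qed.

End Frobenius.

(** * The adjunction between $C \mapsto aC$ and $J \mapsto a^{-1}J$ on right ideals, and the entries
    of $WQ$ *)

Section LeftMultiplication.
Variables (R : finPzRingType) (a : R).
Implicit Types C J : rideal R.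

Lemma ridealP J :
  [/\ 0 \in J, {in J &, forall x y, x - y \in J}
    & forall r, {in J, forall x, x * r \in J}].
Proof.
case: J => A /= /and3P[A0 AB AM]; split=> // [x y Ax Ay | r x Ax].
  by move/forall_inP/(_ x Ax)/forall_inP/(_ y Ay): AB.
by move/forallP/(_ r)/forall_inP/(_ x Ax): AM.
Qed.

Lemma right_idealI (A : {set R}) :
    0 \in A -> {in A &, forall x y, x - y \in A} ->
    (forall r, {in A, forall x, x * r \in A}) ->
  right_ideal A.
Proof.
move=> A0 AB AM; apply/and3P; split=> //.
- by apply/forall_inP => x Ax; apply/forall_inP => y Ay; apply: AB.
- by apply/forallP => r; apply/forall_inP => x Ax; apply: AM.
Qed.

Fact rmul_subproof C : right_ideal [set a * x | x in C].
Proof.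
have [C0 CB CM] := ridealP C.
apply: right_idealI => [|_ _ /imsetP[x Cx ->] /imsetP[y Cy ->]|r _ /imsetP[x Cx ->]].
- by apply/imsetP; exists 0; rewrite ?mulr0.
- by apply/imsetP; exists (x - y); rewrite ?CB ?mulrBr.
- by apply/imsetP; exists (x * r); rewrite ?CM ?mulrA.
Qed.
Definition rmul C : rideal R := RIdeal (rmul_subproof C).

Fact rcolon_subproof J : right_ideal [set x | a * x \in J].
Proof.
have [J0 JB JM] := ridealP J.
apply: right_idealI => [|x y|r x]; rewrite !inE.
- by rewrite mulr0.
- by move=> *; rewrite mulrBr JB.
- by move=> *; rewrite mulrA JM.
Qed.
Definition rcolon J : rideal R := RIdeal (rcolon_subproof J).

Lemma rmul_le C J : (rmul C <= J)%O = (C <= rcolon J)%O.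
Proof.
apply/subsetP/subsetP => h x; first by move=> Cx; rewrite inE h ?imset_f.
by case/imsetP=> y /h; rewrite inE => ? ->.
Qed.

Lemma rmul_rprinc c : rmul (rprinc c) = rprinc (a * c).
Proof.
apply: val_inj; rewrite /= -imset_comp.
by apply: eq_imset => r /=; rewrite mulrA.
Qed.

Lemma rmul_le_rprinc C : (rmul C <= rprinc a)%O.
Proof. by apply/subsetP => _ /imsetP[x _ ->]; apply: imset_f. Qed.

Lemma rann_le_rcolon J : (rann (lprinc a) <= rcolon J)%O.
Proof.
apply/subsetP => x; rewrite rann_lprinc inE => /eqP->.
by case: (ridealP J).
Qed.

(** Every element of $J \le aR$ has the form $ar$ with $r \in a^{-1}J$; if $a^{-1}J$ annihilates
    $Ra$, all of these vanish. *)
Lemma rann_eq_rcolon J :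
  (J <= rprinc a)%O -> (rann (lprinc a) == rcolon J) = (rprinc 0 == J).
Proof.
move=> /subsetP le_Ja; have [J0 _ _] := ridealP J.
have le0 : (rprinc 0 <= J)%O.
  by apply/subsetP => _ /imsetP[r _ ->]; rewrite mul0r.
apply/eqP/eqP => [eq_r|<-].
  apply: le_anti; rewrite le0; apply/subsetP => x Jx.
  have /imsetP[r _ def_x] := le_Ja x Jx.
  have : r \in rann (lprinc a) by rewrite eq_r inE -def_x.
  rewrite rann_lprinc -def_x => /eqP->.
  by apply/imsetP; exists 0; rewrite ?mulr0.
apply: val_inj; apply/setP => x; rewrite rann_lprinc inE.
apply/eqP/imsetP => [->|[r _ ->]]; last by rewrite mul0r.
by exists 0; rewrite ?mul0r.
Qed.

Lemma sum_fiber_rmul_eq0 (B : rideal R) J :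
    ~~ (rann (lprinc a) <= B)%O ->
  \sum_(C | rmul C == J) moebius B C = 0.
Proof.
move=> nle; apply: (@eq_of_sum_le _ _ _ (fun J => \sum_(C | rmul C == J) moebius B C)
    (fun=> 0) J) => // K _.
rewrite (sum_le_fiber_moebius _ _ rmul_le) big1 //.
by case: eqP nle => // ->; rewrite rann_le_rcolon.
Qed.

Lemma sum_fiber_rmul J :
    (J <= rprinc a)%O ->
  \sum_(C | rmul C == J) moebius (rann (lprinc a)) C = moebius (rprinc 0) J.
Proof.
apply: (@eq_of_sum_le _ _ _
  (fun J => \sum_(C | rmul C == J) moebius (rann (lprinc a)) C)) => K le_K.
by rewrite (sum_le_fiber_moebius _ _ rmul_le) sum_le_moebius rann_eq_rcolon.
Qed.

Lemma weight_moebius_mxE (w : R -> rat) (b : R) :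
    (forall J, exists c, J = rprinc c) -> biinvariant w ->
  (weight_mx w *m moebius_mx R) (enum_rank (lprinc a)) (enum_rank (lprinc b))
  = \sum_(J : rideal R | (J <= rprinc a)%O)
      w (rgen J) * (\sum_(C | rmul C == J) moebius (rann (lprinc b)) C)%:~R.
Proof.
move=> rpid inv_w; rewrite mxE.
rewrite (reindex (@enum_rank _)) /=; last first.
  by exists enum_val => i _; rewrite ?enum_rankK ?enum_valK.
rewrite (partition_big rmul (fun J => (J <= rprinc a)%O)) /=; last first.
  by move=> C _; apply: rmul_le_rprinc.
apply: eq_bigr => J _; rewrite rmorph_sum mulr_sumr.
apply: eq_bigr => C /eqP<-; have [c ->] := rpid C.
rewrite weight_mxE // rmul_rprinc weight_rgenE //.
by rewrite mxE !enum_rankK.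
Qed.

End LeftMultiplication.

Theorem theorem4p3 (R : finPzRingType) (w : R -> rat)
    (hR : principal_ideal_ring R) (hw : biinvariant w) :
  let WQ := weight_mx w *m moebius_mx R in
  (forall a b : R, ~~ (lprinc b <= lprinc a)%O ->
     WQ (enum_rank (lprinc a)) (enum_rank (lprinc b)) = 0)
  /\ (forall a : R,
     WQ (enum_rank (lprinc a)) (enum_rank (lprinc a))
     = \sum_(J : rideal R | (J <= rprinc a)%O)
         w (rgen J) * (moebius (rprinc 0) J)%:~R).
Proof.
have [lpid rpid] := hR; split=> [a b nle|a]; rewrite weight_moebius_mxE //.
  rewrite big1 // => J _; rewrite sum_fiber_rmul_eq0 ?mulr0 //.
  by apply: contra nle; apply: lprinc_le_rann.
by apply: eq_bigr => J le_Ja; rewrite sum_fiber_rmul.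
Qed.
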